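(* Let $V$ be a quadratic space over a field $\mathbb F$ of characteristic not $2$, let $e_0\in\operatorname{rad}V$ be nonzero, and let $W$ be a complement of $\mathbb F e_0$ in $V$. Then for every $X\in\operatorname{Cl}(V)$ there exists $Y\in\operatorname{Cl}(W)$ such that $X=\operatorname{Cl}(\pi_W)(X)+Ye_0$.
   Context: A quadratic space $V=(V,b)$ over $\mathbb F$ is an $\mathbb F$-vector space (not necessarily finite-dimensional) with a symmetric bilinear form $b:V\times V\to\mathbb F$, with no further restriction on $b$. Its radical is $\operatorname{rad}V=\{v\in V: b(v,v')=0\ \forall v'\in V\}$. A linear map between quadratic spaces is an isometry if it preserves the bilinear forms (it need not be injective or surjective). For $e_0\in\operatorname{rad}V$ the form $b$ descends to $V/\mathbb F e_0$, making it a quadratic space, and the canonical projection $\pi:V\to V/\mathbb F e_0$ is an isometry. A complement $W$ of $\mathbb F e_0$ is a linear subspace with $V=W\oplus\mathbb F e_0$; it is a quadratic space with the restricted form. The canonical section $\omega_W:V/\mathbb F e_0\to W\subseteq V$ is the inverse of the restriction $\pi|_W:W\to V/\mathbb F e_0$, and the Playfair projection is the isometry $\pi_W=\omega_W\circ\pi:V\to V$, with image $W$. The Clifford algebra is $\operatorname{Cl}(V)=T(V)/J(V)$, where $T(V)$ is the tensor algebra and $J(V)$ is the two-sided ideal generated by all $u\otimes v+v\otimes u-2b(u,v)$, $u,v\in V$. For an isometry $f:V\to V'$, $\operatorname{Cl}(f):\operatorname{Cl}(V)\to\operatorname{Cl}(V')$ is the unique unital algebra homomorphism extending $f$. $\operatorname{Cl}(W)$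 is identified with the subalgebra of $\operatorname{Cl}(V)$ generated by $W$. *)

(* Defs.v *)
(* Clifford algebras of (possibly infinite-dimensional) quadratic spaces,
   in the MathComp world (classical axioms from mathcomp.classical.boolp). *)
From HB Require Import structures.
From mathcomp Require Import all_boot all_order all_algebra.
From mathcomp Require Import finmap boolp.
From mathcomp Require Import monalg.

Set Implicit Arguments.
Unset Strict Implicit.
Unset Printing Implicit Defensive.

Import GRing.Theory.
Local Open Scope ring_scope.
Local Open Scope quotient_scope.

Section Generation.
Variables (F : fieldType) (A : algType F).

Definition twosided_ideal (I : {pred A}) : Prop :=
  [/\ 0 \in I,
      {in I &, forall x y, x + y \in I} &
      forall a, {in I, forall x, a * x \in I /\ x * a \in I}].

Definition ideal_gen (S : A -> Prop) : {pred A} :=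
  fun x => `[< forall I : {pred A},
    twosided_ideal I -> (forall s, S s -> s \in I) -> x \in I >].

Definition subalg_gen (S : A -> Prop) : {pred A} :=
  fun x => `[< forall B : {pred A},
    GRing.subalg_closed B -> (forall s, S s -> s \in B) -> x \in B >].

Lemma ideal_genP (S : A -> Prop) (x : A) :
  reflect (forall I : {pred A},
    twosided_ideal I -> (forall s, S s -> s \in I) -> x \in I)
    (x \in ideal_gen S).
Proof. exact: asboolP. Qed.

Lemma subalg_genP (S : A -> Prop) (x : A) :
  reflect (forall B : {pred A},
    GRing.subalg_closed B -> (forall s, S s -> s \in B) -> x \in B)
    (x \in subalg_gen S).
Proof. exact: asboolP. Qed.

Lemma mem_ideal_gen (S : A -> Prop) s : S s -> s \in ideal_gen S.
Proof. by move=> Ss; apply/ideal_genP => I _; apply. Qed.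

Lemma mem_subalg_gen (S : A -> Prop) s : S s -> s \in subalg_gen S.
Proof. by move=> Ss; apply/subalg_genP => B _; apply. Qed.

Lemma ideal_gen_twosided (S : A -> Prop) : twosided_ideal (ideal_gen S).
Proof.
split=> [|x y /ideal_genP Ix /ideal_genP Iy|a x /ideal_genP Ix].
- by apply/ideal_genP => I [].
- apply/ideal_genP => I idI SI; case: (idI) => _ + _.
  by apply; [exact: Ix | exact: Iy].
- by split; apply/ideal_genP => I idI SI; case: (idI) => _ _ H;
     case: (H a x (Ix I idI SI)).
Qed.

Lemma subalg_gen_closed (S : A -> Prop) : GRing.subalg_closed (subalg_gen S).
Proof.
split=> [|a x y /subalg_genP Bx /subalg_genP By|x y /subalg_genP Bx /subalg_genP By];
  apply/subalg_genP => B clB SB; case: (clB) => B1 Blin Bmul //.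
- by apply: Blin; [exact: Bx | exact: By].
- by apply: Bmul; [exact: Bx | exact: By].
Qed.

End Generation.

(* [algType] requires 1 != 0, so only proper ideals may be divided out. *)
HB.mixin Record isProperTwosided (F : fieldType) (A : algType F)
    (I : A -> bool) := {
  twosided_subproof : twosided_ideal I;
  proper_subproof : 1 \notin (I : {pred A})
}.

#[short(type="properIdeal")]
HB.structure Definition ProperTwosided (F : fieldType) (A : algType F) :=
  { I of GRing.ZmodClosed A I & isProperTwosided F A I }.

HB.factory Record isProperTwosidedIdeal (F : fieldType) (A : algType F)
    (I : A -> bool) := {
  ptwosided_subproof : twosided_ideal I;
  pproper_subproof : 1 \notin (I : {pred A})
}.
HB.builders Context F A I of isProperTwosidedIdeal F A I.
Lemma zmod_closed_twosided : zmod_closed I.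
Proof.
case: ptwosided_subproof => I0 ID IM; split=> // x y Ix Iy.
by apply: ID => //; rewrite -mulN1r; case: (IM (- 1) y Iy).
Qed.
HB.instance Definition _ := GRing.isZmodClosed.Build A I zmod_closed_twosided.
HB.instance Definition _ :=
  isProperTwosided.Build F A I ptwosided_subproof pproper_subproof.
HB.end.

Definition quot_alg (F : fieldType) (A : algType F) (I : properIdeal A) :=
  {ideal_quot I}.
HB.instance Definition _ (F : fieldType) (A : algType F) (I : properIdeal A) :=
  Choice.on (quot_alg I).

(* Locking the operations keeps unification from unfolding the quotients. *)
HB.lock Definition qa_proj (F : fieldType) (A : algType F) (I : properIdeal A)
  (x : A) : quot_alg I := \pi_{ideal_quot I} x.
HB.lock Definition qa_repr (F : fieldType) (A : algType F) (I : properIdeal A)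
  (q : quot_alg I) : A := repr (q : {ideal_quot I}).
HB.lock Definition qa_zero (F : fieldType) (A : algType F) (I : properIdeal A)
  : quot_alg I := qa_proj I 0.
HB.lock Definition qa_opp (F : fieldType) (A : algType F) (I : properIdeal A)
  (x : quot_alg I) : quot_alg I := qa_proj I (- qa_repr x).
HB.lock Definition qa_add (F : fieldType) (A : algType F) (I : properIdeal A)
  (x y : quot_alg I) : quot_alg I := qa_proj I (qa_repr x + qa_repr y).
HB.lock Definition qa_one (F : fieldType) (A : algType F) (I : properIdeal A)
  : quot_alg I := qa_proj I 1.
HB.lock Definition qa_mul (F : fieldType) (A : algType F) (I : properIdeal A)
  (x y : quot_alg I) : quot_alg I := qa_proj I (qa_repr x * qa_repr y).
HB.lock Definition qa_scale (F : fieldType) (A : algType F) (I : properIdeal A)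
  (a : F) (x : quot_alg I) : quot_alg I := qa_proj I (a *: qa_repr x).

HB.lock Definition qa_lift (F : fieldType) (A : algType F) (I : properIdeal A)
  (B : algType F) (f : {lrmorphism A -> B}) (f0 : {in I, forall x, f x = 0})
  (q : quot_alg I) : B := f (qa_repr q).

Section QuotientAlgebra.
Variables (F : fieldType) (A : algType F) (I : properIdeal A).
Local Notation quot_alg := (quot_alg I).
Local Notation qa_proj := (@qa_proj F A I).
Local Notation qa_repr := (@qa_repr F A I).

Lemma qa_reprK : cancel qa_repr qa_proj.
Proof. rewrite qa_proj.unlock qa_repr.unlock; exact: (@reprK _ {ideal_quot I}). Qed.

Lemma qa_projP (x y : A) : reflect (qa_proj x = qa_proj y) (x - y \in I).
Proof. by rewrite Quotient.idealrBE qa_proj.unlock; exact: eqP. Qed.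

Lemma qa_ind (P : quot_alg -> Prop) : (forall x, P (qa_proj x)) -> forall q, P q.
Proof. by move=> H q; rewrite -[q]qa_reprK. Qed.

Let idealM a x : x \in I -> a * x \in I.
Proof. by case: (@twosided_subproof _ _ I) => _ _ H /(H a) []. Qed.
Let idealMr a x : x \in I -> x * a \in I.
Proof. by case: (@twosided_subproof _ _ I) => _ _ H /(H a) []. Qed.

Local Notation qa_zero := (@qa_zero F A I).
Local Notation qa_opp := (@qa_opp F A I).
Local Notation qa_add := (@qa_add F A I).
Local Notation qa_one := (@qa_one F A I).
Local Notation qa_mul := (@qa_mul F A I).
Local Notation qa_scale := (@qa_scale F A I).

Lemma qa_repr_proj x : qa_repr (qa_proj x) - x \in I.
Proof. by apply/qa_projP; rewrite qa_reprK. Qed.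

Lemma qa_oppE x : qa_opp (qa_proj x) = qa_proj (- x).
Proof.
rewrite qa_opp.unlock; apply/qa_projP; rewrite -opprD -mulN1r.
exact/idealM/qa_repr_proj.
Qed.

Lemma qa_addE x y : qa_add (qa_proj x) (qa_proj y) = qa_proj (x + y).
Proof.
rewrite qa_add.unlock; apply/qa_projP; rewrite opprD addrACA.
by apply: rpredD; exact: qa_repr_proj.
Qed.

Lemma qa_mulE x y : qa_mul (qa_proj x) (qa_proj y) = qa_proj (x * y).
Proof.
rewrite qa_mul.unlock; apply/qa_projP; set x' := qa_repr _; set y' := qa_repr _.
have -> : x' * y' - x * y = x' * (y' - y) + (x' - x) * y.
  by rewrite mulrBr mulrBl addrA subrK.
by apply: rpredD; [apply: idealM | apply: idealMr]; exact: qa_repr_proj.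
Qed.

Lemma qa_scaleE a x : qa_scale a (qa_proj x) = qa_proj (a *: x).
Proof.
rewrite qa_scale.unlock; apply/qa_projP; rewrite -scalerBr -mulr_algl.
exact/idealM/qa_repr_proj.
Qed.

Lemma qa_oneE : qa_one = qa_proj 1. Proof. by rewrite qa_one.unlock. Qed.
Lemma qa_zeroE : qa_zero = qa_proj 0. Proof. by rewrite qa_zero.unlock. Qed.

Lemma qa_addA : associative qa_add.
Proof.
by elim/qa_ind=> x; elim/qa_ind=> y; elim/qa_ind=> z; rewrite !qa_addE addrA.
Qed.
Lemma qa_addC : commutative qa_add.
Proof. by elim/qa_ind=> x; elim/qa_ind=> y; rewrite !qa_addE addrC. Qed.
Lemma qa_add0 : left_id qa_zero qa_add.
Proof. by elim/qa_ind=> x; rewrite qa_zeroE qa_addE add0r. Qed.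
Lemma qa_addN : left_inverse qa_zero qa_opp qa_add.
Proof. by elim/qa_ind=> x; rewrite qa_oppE qa_zeroE qa_addE addNr. Qed.
HB.instance Definition _ := GRing.isZmodule.Build quot_alg
  qa_addA qa_addC qa_add0 qa_addN.

Lemma qa_proj_zmod : zmod_morphism qa_proj.
Proof. by move=> x y; rewrite -qa_addE -qa_oppE. Qed.
HB.instance Definition _ :=
  GRing.isZmodMorphism.Build A quot_alg qa_proj qa_proj_zmod.

Lemma qa_mulA : associative qa_mul.
Proof.
by elim/qa_ind=> x; elim/qa_ind=> y; elim/qa_ind=> z; rewrite !qa_mulE mulrA.
Qed.
Lemma qa_mul1 : left_id qa_one qa_mul.
Proof. by elim/qa_ind=> x; rewrite qa_oneE qa_mulE mul1r. Qed.
Lemma qa_mulr1 : right_id qa_one qa_mul.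
Proof. by elim/qa_ind=> x; rewrite qa_oneE qa_mulE mulr1. Qed.
Lemma qa_mulDl : left_distributive qa_mul qa_add.
Proof.
by elim/qa_ind=> x; elim/qa_ind=> y; elim/qa_ind=> z;
  rewrite !(qa_addE, qa_mulE) mulrDl.
Qed.
Lemma qa_mulDr : right_distributive qa_mul qa_add.
Proof.
by elim/qa_ind=> x; elim/qa_ind=> y; elim/qa_ind=> z;
  rewrite !(qa_addE, qa_mulE) mulrDr.
Qed.
Lemma qa_one_neq0 : qa_one != 0.
Proof.
apply/eqP; rewrite qa_oneE -(raddf0 qa_proj) => /qa_projP; rewrite subr0.
exact/negP/(@proper_subproof _ _ I).
Qed.
HB.instance Definition _ := GRing.Zmodule_isNzRing.Build quot_alg
  qa_mulA qa_mul1 qa_mulr1 qa_mulDl qa_mulDr qa_one_neq0.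

Lemma qa_scaleA a c x : qa_scale a (qa_scale c x) = qa_scale (a * c) x.
Proof. by elim/qa_ind: x => x; rewrite !qa_scaleE scalerA. Qed.
Lemma qa_scale1 : left_id 1 qa_scale.
Proof. by elim/qa_ind=> x; rewrite !qa_scaleE scale1r. Qed.
Lemma qa_scaleDr : right_distributive qa_scale qa_add.
Proof.
by move=> a; elim/qa_ind=> x; elim/qa_ind=> y;
  rewrite !(qa_addE, qa_scaleE) scalerDr.
Qed.
Lemma qa_scaleDl x : {morph qa_scale^~ x : a c / a + c >-> qa_add a c}.
Proof.
by move=> a c; elim/qa_ind: x=> x; rewrite !(qa_addE, qa_scaleE) scalerDl.
Qed.
HB.instance Definition _ := GRing.Zmodule_isLmodule.Build F quot_alg
  qa_scaleA qa_scale1 qa_scaleDr qa_scaleDl.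

Lemma qa_scaleAl (a : F) (x y : quot_alg) : a *: (x * y) = (a *: x) * y.
Proof.
elim/qa_ind: x => x; elim/qa_ind: y => y.
by rewrite /GRing.scale /GRing.mul /= !(qa_mulE, qa_scaleE) scalerAl.
Qed.
HB.instance Definition _ := GRing.Lmodule_isLalgebra.Build F quot_alg qa_scaleAl.
Lemma qa_scaleAr (a : F) (x y : quot_alg) : a *: (x * y) = x * (a *: y).
Proof.
elim/qa_ind: x => x; elim/qa_ind: y => y.
by rewrite /GRing.scale /GRing.mul /= !(qa_mulE, qa_scaleE) scalerAr.
Qed.
HB.instance Definition _ := GRing.Lalgebra_isAlgebra.Build F quot_alg qa_scaleAr.

Lemma qa_proj_monoid : monoid_morphism qa_proj.
Proof. by split=> [|x y]; rewrite -?qa_oneE -?qa_mulE. Qed.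
Lemma qa_proj_scalable : scalable qa_proj.
Proof. by move=> a x; rewrite -qa_scaleE. Qed.
HB.instance Definition _ := GRing.isMonoidMorphism.Build A quot_alg qa_proj qa_proj_monoid.
HB.instance Definition _ := GRing.isScalable.Build F A quot_alg *:%R qa_proj qa_proj_scalable.

Lemma qa_proj_eq0 (x : A) : (qa_proj x == 0) = (x \in I).
Proof. by rewrite -[x in RHS]subr0; apply/eqP/qa_projP; rewrite raddf0. Qed.

Lemma qa_proj_surj (q : quot_alg) : exists x, q = qa_proj x.
Proof. by exists (qa_repr q); rewrite qa_reprK. Qed.

Section Lift.
Variables (B : algType F) (f : {lrmorphism A -> B}).
Hypothesis f0 : {in I, forall x, f x = 0}.

Local Notation lift := (qa_lift f0).

Lemma qa_liftE x : lift (qa_proj x) = f x.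
Proof.
apply/eqP; rewrite qa_lift.unlock -subr_eq0 -raddfB; apply/eqP/f0/qa_projP.
by rewrite qa_reprK.
Qed.

Lemma qa_lift_zmod : zmod_morphism lift.
Proof.
by elim/qa_ind=> x; elim/qa_ind=> y; rewrite  -raddfB !qa_liftE raddfB.
Qed.
Lemma qa_lift_monoid : monoid_morphism lift.
Proof.
split; first by rewrite -(rmorph1 qa_proj) qa_liftE rmorph1.
by elim/qa_ind=> x; elim/qa_ind=> y; rewrite  -rmorphM !qa_liftE rmorphM.
Qed.
Lemma qa_lift_scalable : scalable lift.
Proof.
by move=> a; elim/qa_ind=> x; rewrite -linearZ !qa_liftE linearZ.
Qed.
HB.instance Definition _ := GRing.isZmodMorphism.Build quot_alg B lift qa_lift_zmod.
HB.instance Definition _ := GRing.isMonoidMorphism.Build quot_alg B lift qa_lift_monoid.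
HB.instance Definition _ := GRing.isScalable.Build F quot_alg B *:%R lift qa_lift_scalable.

End Lift.

End QuotientAlgebra.

Lemma lrmorph_ideal_gen (F : fieldType) (A B : algType F)
  (f : {lrmorphism A -> B}) (S : A -> Prop) :
  (forall s, S s -> f s = 0) -> {in ideal_gen S, forall x, f x = 0}.
Proof.
move=> Sf x /ideal_genP /(_ (fun x => f x == 0)) H; apply/eqP; apply: H.
- split=> [|y z|a y]; rewrite -!topredE /=; first by rewrite raddf0.
    by move=> /eqP fy /eqP fz; rewrite raddfD /= fy fz addr0.
  by move=> /eqP fy; rewrite !rmorphM /= fy mulr0 mul0r.
- by move=> s /Sf; rewrite -topredE /= => ->.
Qed.

Lemma ideal_gen_proper (F : fieldType) (A B : algType F)
  (f : {lrmorphism A -> B}) (S : A -> Prop) :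
  (forall s, S s -> f s = 0) -> 1 \notin ideal_gen S.
Proof.
move=> Sf; apply/negP => /(lrmorph_ideal_gen Sf) /eqP.
by rewrite rmorph1 oner_eq0.
Qed.

(* The free (noncommutative) algebra on the set V: finitely supported
   F-valued functions on words over V, with convolution product. *)
Definition free_alg (F : fieldType) (V : choiceType) := {malg F[{fmonom V}]}.
HB.instance Definition _ (F : fieldType) (V : choiceType) :=
  GRing.Lalgebra.on (free_alg F V).

HB.lock Definition free_gen (F : fieldType) (V : choiceType) (v : V) :
  free_alg F V := << fmu v >>.

Definition word_eval (F : fieldType) (V : choiceType) (B : algType F)
  (g : V -> B) (m : {fmonom V}) : B := \prod_(v <- m) g v.
HB.lock Definition free_lift (F : fieldType) (V : choiceType) (B : algType F)
  (g : V -> B) : free_alg F V -> B := mmap (in_alg B) (word_eval g).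

Section FreeAlgebra.
Variables (F : fieldType) (V : choiceType).
Local Notation free_alg := (free_alg F V).
Local Notation free_gen := (@free_gen F V).

Lemma free_alg_scaleAr (a : F) (x y : free_alg) : a *: (x * y) = x * (a *: y).
Proof.
rewrite -[a *: y]mul_malgC mulrA; have -> : x * a%:MP = a *: x.
  rewrite -mul_malgC [LHS]fgmulgU [RHS]fgmulUg.
  by apply: eq_bigr => k _; rewrite mulrC mulm1 mul1m.
by rewrite scalerAl.
Qed.
HB.instance Definition _ :=
  GRing.Lalgebra_isAlgebra.Build F free_alg free_alg_scaleAr.

Lemma free_alg_ind (P : free_alg -> Prop) :
    P 1 -> (forall a x y, P x -> P y -> P (a *: x + y)) ->
    (forall v x, P x -> P (free_gen v * x)) -> forall x, P x.
Proof.
move=> P1 PD PM.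
have P0 : P 0 by have := PD (-1) _ _ P1 P1; rewrite scaleN1r addNr.
have Pm (m : {fmonom V}) : P << m >>.
  case: m => s; elim: s => [|v s IHs].
    by rewrite -fmoneE.
  have -> : << FMonom (v :: s) >> = free_gen v * << FMonom s >> :> free_alg.
    by rewrite free_gen.unlock [RHS]fgmulUU mulr1 /mmul /= fmmulE fmuE.
  exact: PM.
move=> x; rewrite [x]monalgE; elim/big_ind: _ => // [y z Py Pz|m _].
  by rewrite -[y]scale1r; exact: PD.
have -> : << x@_m *g m >> = x@_m *: << m >> + 0 :> free_alg.
  by rewrite addr0 -mul_malgC [RHS]fgmulUU mulr1 mul1m.
exact: PD.
Qed.

Section FreeLift.
Variables (B : algType F) (g : V -> B).

Local Notation word_eval := (word_eval g).
Lemma word_eval_mmorph : mmorphism word_eval.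
Proof.
split=> [m1 m2|]; first by rewrite /word_eval fmM big_cat.
by rewrite /word_eval fm1 big_nil.
Qed.
HB.instance Definition _ :=
  monalg.isMultiplicative.Build {fmonom V} B word_eval word_eval_mmorph.

Local Notation free_lift := (@free_lift F V B g).

Lemma free_lift_zmod : zmod_morphism free_lift.
Proof. by rewrite free_lift.unlock; exact: (raddfB (mmap (in_alg B) word_eval)). Qed.
Lemma free_lift_monoid : monoid_morphism free_lift.
Proof.
rewrite free_lift.unlock.
have [H1 H2] : multiplicative (mmap (in_alg B) word_eval).
  apply: commr_mmap_is_multiplicative => x m m'.
  by rewrite /GRing.comm /= mulr_algl mulr_algr.
by split.
Qed.
Lemma free_lift_scalable : scalable free_lift.
Proof. by move=> a x; rewrite free_lift.unlock [LHS]mmapZ /= mulr_algl. Qed.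
HB.instance Definition _ :=
  GRing.isZmodMorphism.Build free_alg B free_lift free_lift_zmod.
HB.instance Definition _ :=
  GRing.isMonoidMorphism.Build free_alg B free_lift free_lift_monoid.
HB.instance Definition _ :=
  GRing.isScalable.Build F free_alg B *:%R free_lift free_lift_scalable.

Lemma free_lift_gen v : free_lift (free_gen v) = g v.
Proof.
rewrite free_gen.unlock free_lift.unlock mmapU /= scale1r mul1r /word_eval fmU.
by rewrite big_seq1.
Qed.
End FreeLift.
End FreeAlgebra.

Section TensorAlgebra.
Variables (F : fieldType) (V : lmodType F).

(* T(V) is presented as the free algebra on the set V modulo the linearity of
   the generators; [tensor_lift], [tensor_lift_gen] and [tensor_lift_unique]
   below are its universal property. *)
Definition tensor_rel (t : free_alg F V) : Prop :=
  exists (a : F) (u v : V),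
    t = free_gen F (a *: u + v) - (a *: free_gen F u + free_gen F v).

Definition tensor_ideal : {pred free_alg F V} := ideal_gen tensor_rel.

Lemma free_lift_rel (B : algType F) (f : {linear V -> B}) t :
  tensor_rel t -> free_lift f t = 0.
Proof.
move=> [a [u [v ->]]]; rewrite linearB linearP /= !free_lift_gen.
by rewrite linearP subrr.
Qed.

Lemma tensor_ideal_proper : 1 \notin tensor_ideal.
Proof. exact: (ideal_gen_proper (@free_lift_rel F^o \0)). Qed.

HB.instance Definition _ := isProperTwosidedIdeal.Build F (free_alg F V)
  tensor_ideal (ideal_gen_twosided tensor_rel) tensor_ideal_proper.

Definition tensor_alg := quot_alg tensor_ideal.
HB.instance Definition _ := GRing.Algebra.on tensor_alg.

Definition tensor_gen (v : V) : tensor_alg := qa_proj tensor_ideal (free_gen F v).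

Lemma tensor_gen_linear : linear tensor_gen.
Proof.
move=> a u v; rewrite /tensor_gen -linearP; apply/qa_projP.
by apply: mem_ideal_gen; exists a, u, v.
Qed.
HB.instance Definition _ :=
  GRing.isLinear.Build F V tensor_alg *:%R tensor_gen tensor_gen_linear.

Lemma tensor_alg_ind (P : tensor_alg -> Prop) :
    P 1 -> (forall a x y, P x -> P y -> P (a *: x + y)) ->
    (forall v x, P x -> P (tensor_gen v * x)) -> forall x, P x.
Proof.
move=> P1 PD PM; elim/qa_ind; elim/free_alg_ind => [|a x y Px Py|v x Px].
- by rewrite rmorph1.
- by rewrite linearP; exact: PD.
- by rewrite rmorphM; exact: PM.
Qed.

Section TensorLift.
Variables (B : algType F) (f : {linear V -> B}).

Definition tensor_lift : tensor_alg -> B :=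
  qa_lift (I := tensor_ideal) (lrmorph_ideal_gen (free_lift_rel f)).
HB.instance Definition _ := GRing.LRMorphism.on tensor_lift.

Lemma tensor_lift_gen v : tensor_lift (tensor_gen v) = f v.
Proof. by rewrite /tensor_lift qa_liftE /= free_lift_gen. Qed.
End TensorLift.

Lemma tensor_lift_unique (B : algType F) (g h : {lrmorphism tensor_alg -> B}) :
  (forall v, g (tensor_gen v) = h (tensor_gen v)) -> g =1 h.
Proof.
move=> gh; elim/tensor_alg_ind => [|a x y gx gy|v x gx].
- by rewrite !rmorph1.
- by rewrite !linearP /= gx gy.
- by rewrite !rmorphM /= gh gx.
Qed.

End TensorAlgebra.

Section EndAlgebra.
Variables (F : fieldType) (M : lmodType F).

Lemma linear_funext (f g : {linear M -> M}) : f =1 g -> f = g.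
Proof.
case: f g => [f [[mf1] [mf2]]] [g [[mg1] [mg2]]] /= /funext fg.
rewrite fg in mf1 mf2 *.
by rewrite (Prop_irrelevance mf1 mg1) (Prop_irrelevance mf2 mg2).
Qed.

Record endo (M_neq0 : exists m : M, m != 0) := Endo { endo_fun :> {linear M -> M} }.
Variable M_neq0 : exists m : M, m != 0.
Local Notation E := (endo M_neq0).
HB.instance Definition _ := gen_eqMixin E.
HB.instance Definition _ := gen_choiceMixin E.

Lemma endoP (f g : E) : f =1 g -> f = g.
Proof. by case: f g => [f] [g] /= /linear_funext ->. Qed.

Let add (f g : E) : E := Endo M_neq0 (f \+ g).
Let opp (f : E) : E := Endo M_neq0 (\- f).
Let zero : E := Endo M_neq0 \0.
Let one : E := Endo M_neq0 idfun.
Let mul (f g : E) : E := Endo M_neq0 (f \o g).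
Let scale_fun (a : F) (f : E) (x : M) := a *: f x.
Let scale_fun_linear a f : linear (scale_fun a f).
Proof.
by move=> k x y; rewrite /scale_fun linearP scalerDr !scalerA mulrC.
Qed.
HB.instance Definition _ a f :=
  GRing.isLinear.Build F M M *:%R (scale_fun a f) (scale_fun_linear a f).
Let scale (a : F) (f : E) : E := Endo M_neq0 (scale_fun a f).

Let addA : associative add.
Proof. by move=> f g h; apply: endoP => x /=; rewrite addrA. Qed.
Let addC : commutative add.
Proof. by move=> f g; apply: endoP => x /=; rewrite addrC. Qed.
Let add0 : left_id zero add.
Proof. by move=> f; apply: endoP => x /=; rewrite add0r. Qed.
Let addN : left_inverse zero opp add.
Proof. by move=> f; apply: endoP => x /=; rewrite addNr. Qed.
HB.instance Definition _ := GRing.isZmodule.Build E addA addC add0 addN.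

Let mulA : associative mul.
Proof. by move=> f g h; apply: endoP. Qed.
Let mul1 : left_id one mul.
Proof. by move=> f; apply: endoP. Qed.
Let mulr1' : right_id one mul.
Proof. by move=> f; apply: endoP. Qed.
Let mulDl : left_distributive mul +%R.
Proof. by move=> f g h; apply: endoP. Qed.
Let mulDr : right_distributive mul +%R.
Proof. by move=> f g h; apply: endoP => x /=; rewrite raddfD. Qed.
Let one_neq0 : one != 0.
Proof.
apply/eqP => E10; have [m /eqP] := M_neq0; apply.
by rewrite -[m]/(one m) E10.
Qed.
HB.instance Definition _ :=
  GRing.Zmodule_isNzRing.Build E mulA mul1 mulr1' mulDl mulDr one_neq0.

Let scaleA a c f : scale a (scale c f) = scale (a * c) f.
Proof. by apply: endoP => x /=; rewrite /scale_fun /= /scale_fun scalerA. Qed.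
Let scale1 : left_id 1 scale.
Proof. by move=> f; apply: endoP => x /=; rewrite /scale_fun scale1r. Qed.
Let scaleDr : right_distributive scale +%R.
Proof. by move=> a f g; apply: endoP => x /=; rewrite /scale_fun scalerDr. Qed.
Let scaleDl f : {morph scale^~ f : a c / a + c}.
Proof. by move=> a c; apply: endoP => x /=; rewrite /scale_fun scalerDl. Qed.
HB.instance Definition _ := GRing.Zmodule_isLmodule.Build F E
  scaleA scale1 scaleDr scaleDl.
Let scaleAl (a : F) (f g : E) : a *: (f * g) = (a *: f) * g.
Proof. by apply: endoP. Qed.
HB.instance Definition _ := GRing.Lmodule_isLalgebra.Build F E scaleAl.
Let scaleAr (a : F) (f g : E) : a *: (f * g) = f * (a *: g).
Proof. by apply: endoP => x /=; rewrite /scale_fun linearZ. Qed.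
HB.instance Definition _ := GRing.Lalgebra_isAlgebra.Build F E scaleAr.

Lemma endoDE (f g : E) x : (f + g) x = f x + g x. Proof. by []. Qed.
Lemma endoME (f g : E) x : (f * g) x = f (g x). Proof. by []. Qed.
Lemma endoZE a (f : E) x : (a *: f) x = a *: f x. Proof. by []. Qed.
Lemma endo0E x : (0 : E) x = 0. Proof. by []. Qed.
Lemma endo1E x : (1 : E) x = x. Proof. by []. Qed.

End EndAlgebra.

Lemma symformC (F : fieldType) (V : lmodType F) (b : {symmetric V}) u v :
  b u v = b v u.
Proof. by rewrite hermitian_subproof expr0 mul1r. Qed.

(* Cl(V) is nonzero: it acts on the exterior algebra by the sum of exterior
   multiplication and contraction. *)
Section Exterior.
Variables (F : fieldType) (V : lmodType F).
Local Notation T := (tensor_alg V).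

Definition ext_rel (t : T) : Prop := exists v, t = tensor_gen v * tensor_gen v.
Definition ext_ideal : {pred T} := ideal_gen ext_rel.

Lemma ext_ideal_proper : 1 \notin ext_ideal.
Proof.
apply: (@ideal_gen_proper F _ F^o (@tensor_lift F V F^o \0)) => _ [v ->].
by rewrite rmorphM /= tensor_lift_gen mul0r.
Qed.
HB.instance Definition _ := isProperTwosidedIdeal.Build F T
  ext_ideal (ideal_gen_twosided ext_rel) ext_ideal_proper.

Definition ext_alg := quot_alg ext_ideal.
HB.instance Definition _ := GRing.Algebra.on ext_alg.

Definition ext_gen (v : V) : ext_alg := qa_proj ext_ideal (tensor_gen v).
Lemma ext_gen_linear : linear ext_gen.
Proof. by move=> a u v; rewrite /ext_gen !linearP. Qed.
HB.instance Definition _ :=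
  GRing.isLinear.Build F V ext_alg *:%R ext_gen ext_gen_linear.

Lemma ext_gen_sqr v : ext_gen v * ext_gen v = 0.
Proof.
apply/eqP; rewrite /ext_gen -rmorphM qa_proj_eq0.
by apply: mem_ideal_gen; exists v.
Qed.

Lemma ext_gen_anti u v : ext_gen u * ext_gen v = - (ext_gen v * ext_gen u).
Proof.
have E : ext_gen (u + v) = ext_gen u + ext_gen v by exact: linearD.
apply/eqP; rewrite -addr_eq0; apply/eqP; have := ext_gen_sqr (u + v).
by rewrite E mulrDl !mulrDr !ext_gen_sqr add0r addr0.
Qed.

Lemma ext_alg_ind (P : ext_alg -> Prop) :
    P 1 -> (forall a x y, P x -> P y -> P (a *: x + y)) ->
    (forall v x, P x -> P (ext_gen v * x)) -> forall x, P x.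
Proof.
move=> P1 PD PM; elim/qa_ind; elim/tensor_alg_ind => [|a x y Px Py|v x Px].
- by rewrite rmorph1.
- by rewrite linearP; exact: PD.
- by rewrite rmorphM; exact: PM.
Qed.

Lemma ext_neq0 : exists m : ext_alg, m != 0.
Proof. by exists 1; exact: oner_neq0. Qed.
Lemma ext2_neq0 : exists m : (ext_alg * ext_alg)%type, m != 0.
Proof.
by exists (1, 0); apply/eqP => -[/eqP]; rewrite oner_eq0.
Qed.

Variable b : {symmetric V}.

Section Contraction.
Variable u : V.

Definition ctr_step (v : V) (p : ext_alg * ext_alg) : ext_alg * ext_alg :=
  (ext_gen v * p.1, b u v *: p.1 - ext_gen v * p.2).
Lemma ctr_step_linear v : linear (ctr_step v).
Proof.
move=> a [x1 x2] [y1 y2].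
have H1 : ext_gen v * (a *: x1 + y1) = a *: (ext_gen v * x1) + ext_gen v * y1.
  by rewrite mulrDr scalerAr.
have H2 : b u v *: (a *: x1 + y1) - ext_gen v * (a *: x2 + y2) =
    a *: (b u v *: x1 - ext_gen v * x2) + (b u v *: y1 - ext_gen v * y2).
  rewrite mulrDr -scalerAr scalerBr scalerDr opprD !scalerA mulrC.
  by rewrite addrACA.
exact: (congr2 pair H1 H2).
Qed.
HB.instance Definition _ v :=
  GRing.isLinear.Build F _ _ *:%R (ctr_step v) (ctr_step_linear v).
Definition ctr_endo (v : V) : endo ext2_neq0 := Endo ext2_neq0 (ctr_step v).
Lemma ctr_endo_linear : linear ctr_endo.
Proof.
move=> a v w; apply: endoP => -[x y].
have H1 : ext_gen (a *: v + w) * x = a *: (ext_gen v * x) + ext_gen w * x.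
  by rewrite linearP mulrDl scalerAl.
have H2 : b u (a *: v + w) *: x - ext_gen (a *: v + w) * y =
    a *: (b u v *: x - ext_gen v * y) + (b u w *: x - ext_gen w * y).
  rewrite linearPr linearP /= scalerDl mulrDl opprD -scalerAl scalerBr scalerA.
  by rewrite addrACA.
exact: (congr2 pair H1 H2).
Qed.
HB.instance Definition _ :=
  GRing.isLinear.Build F V _ *:%R ctr_endo ctr_endo_linear.

Lemma ctr_ext_rel t : ext_rel t -> tensor_lift ctr_endo t = 0.
Proof.
move=> [v ->]; rewrite rmorphM /= tensor_lift_gen; apply: endoP => -[x y].
rewrite endoME endo0E /= /ctr_step /= mulrA ext_gen_sqr mul0r; congr pair.
by rewrite mulrBr mulrA ext_gen_sqr mul0r subr0 scalerAr subrr.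
Qed.
Definition ctr_alg : ext_alg -> endo ext2_neq0 :=
  qa_lift (I := ext_ideal) (lrmorph_ideal_gen ctr_ext_rel).
HB.instance Definition _ := GRing.LRMorphism.on ctr_alg.
Lemma ctr_alg_gen v : ctr_alg (ext_gen v) = ctr_endo v.
Proof. by rewrite /ctr_alg qa_liftE /= tensor_lift_gen. Qed.

Definition ctr (x : ext_alg) : ext_alg := (ctr_alg x (1, 0)).2.

Lemma ctr_fst x : (ctr_alg x (1, 0)).1 = x.
Proof.
elim/ext_alg_ind: x => [|a x y Px Py|v x Px].
- by rewrite rmorph1 endo1E.
- by rewrite linearP endoDE endoZE /= Px Py.
- by rewrite rmorphM endoME /= ctr_alg_gen /= Px.
Qed.

Lemma ctr_linear : linear ctr.
Proof. by move=> a x y; rewrite /ctr linearP endoDE endoZE. Qed.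
HB.instance Definition _ :=
  GRing.isLinear.Build F ext_alg ext_alg *:%R ctr ctr_linear.

Lemma ctr1 : ctr 1 = 0.
Proof. by rewrite /ctr rmorph1 endo1E. Qed.
Lemma ctrM v x : ctr (ext_gen v * x) = b u v *: x - ext_gen v * ctr x.
Proof. by rewrite {1}/ctr rmorphM endoME /= ctr_alg_gen /= ctr_fst. Qed.
End Contraction.

Lemma ctr_linear_l a u v x : ctr (a *: u + v) x = a *: ctr u x + ctr v x.
Proof.
elim/ext_alg_ind: x => [|c x y Px Py|w x Px].
- by rewrite !ctr1 scaler0 addr0.
- rewrite !linearP /= Px Py !scalerDr !scalerA [c * a]mulrC.
  by rewrite -!addrA; congr (_ + _); rewrite addrCA.
- rewrite !ctrM Px linearPl /= scalerDl mulrDr opprD -scalerAr scalerBr scalerA.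
  by rewrite addrACA.
Qed.

Lemma ctr_anti u v x : ctr u (ctr v x) = - ctr v (ctr u x).
Proof.
apply/eqP; rewrite -addr_eq0; apply/eqP.
elim/ext_alg_ind: x => [|c x y Px Py|w x Px].
- by rewrite !ctr1 !raddf0 addr0.
- by rewrite !linearP /= addrACA -scalerDr Px Py scaler0 addr0.
- have E u1 v1 : ctr u1 (ctr v1 (ext_gen w * x)) = b v1 w *: ctr u1 x -
      (b u1 w *: ctr v1 x - ext_gen w * ctr u1 (ctr v1 x)).
    by rewrite ctrM linearB linearZ /= ctrM.
  rewrite !E !opprB addrACA [X in _ + X]addrACA -opprD [b v w *: _ + _]addrC.
  by rewrite addrCA subrr addr0 -mulrDr Px mulr0.
Qed.

Definition cliff_step (v : V) (x : ext_alg) : ext_alg := ext_gen v * x + ctr v x.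
Lemma cliff_step_linear v : linear (cliff_step v).
Proof.
move=> a x y; rewrite /cliff_step linearP mulrDr -scalerAr scalerDr.
by rewrite addrACA.
Qed.
HB.instance Definition _ v :=
  GRing.isLinear.Build F _ _ *:%R (cliff_step v) (cliff_step_linear v).
Definition cliff_endo (v : V) : endo ext_neq0 := Endo ext_neq0 (cliff_step v).
Lemma cliff_endo_linear : linear cliff_endo.
Proof.
move=> a v w; apply: endoP => x; rewrite endoDE endoZE /= /cliff_step.
by rewrite linearP ctr_linear_l mulrDl -scalerAl scalerDr addrACA.
Qed.
HB.instance Definition _ :=
  GRing.isLinear.Build F V _ *:%R cliff_endo cliff_endo_linear.

Lemma cliff_endo_rel u v : cliff_endo u * cliff_endo v + cliff_endo v * cliff_endo u
  = (2%:R * b u v)%:A.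
Proof.
apply: endoP => x; rewrite endoDE !endoME endoZE endo1E /= /cliff_step.
have E u1 v1 : ext_gen u1 * (ext_gen v1 * x + ctr v1 x) +
    ctr u1 (ext_gen v1 * x + ctr v1 x) = b u1 v1 *: x + ctr u1 (ctr v1 x) +
      (ext_gen u1 * ext_gen v1 * x) + (ext_gen u1 * ctr v1 x - ext_gen v1 * ctr u1 x).
  rewrite linearD /= ctrM mulrDr mulrA.
  by rewrite [X in _ + X]addrAC addrACA [X in X + _]addrC.
rewrite !E ctr_anti (ext_gen_anti u v) (symformC b v u) mulNr.
set p := b u v *: x; set q := ctr v _; set r := _ * x.
set s := ext_gen u * _; set t := ext_gen v * _.
rewrite mulr_natl mulr2n scalerDl -/p addrACA.
have -> : s - t + (t - s) = 0 by rewrite -[t - s]opprB subrr.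
rewrite addr0 addrACA addNr addr0 addrACA addNr addr0.
by [].
Qed.

End Exterior.

Section Clifford.
Variables (F : fieldType) (V : lmodType F) (b : {symmetric V}).
Local Notation T := (tensor_alg V).

Definition cliff_rel (t : T) : Prop :=
  exists u v : V, t = tensor_gen u * tensor_gen v + tensor_gen v * tensor_gen u
                      - (2%:R * b u v)%:A.

Definition cliff_ideal : {pred T} := ideal_gen cliff_rel.

Lemma tensor_lift_cliff_rel (B : algType F) (f : {linear V -> B}) :
    (forall u v, f u * f v + f v * f u = (2%:R * b u v)%:A) ->
  forall t, cliff_rel t -> tensor_lift f t = 0.
Proof.
move=> fM _ [u [v ->]]; rewrite rmorphB rmorphD !rmorphM /= !tensor_lift_gen fM.
by rewrite linearZ /= rmorph1 subrr.
Qed.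

Lemma cliff_ideal_proper : 1 \notin cliff_ideal.
Proof. exact: (ideal_gen_proper (tensor_lift_cliff_rel (cliff_endo_rel b))). Qed.

HB.instance Definition _ := isProperTwosidedIdeal.Build F T
  cliff_ideal (ideal_gen_twosided cliff_rel) cliff_ideal_proper.

Definition clifford := quot_alg cliff_ideal.
HB.instance Definition _ := GRing.Algebra.on clifford.

Definition cliff_gen (v : V) : clifford := qa_proj cliff_ideal (tensor_gen v).
Lemma cliff_gen_linear : linear cliff_gen.
Proof. by move=> a u v; rewrite /cliff_gen !linearP. Qed.
HB.instance Definition _ :=
  GRing.isLinear.Build F V clifford *:%R cliff_gen cliff_gen_linear.

Lemma cliff_genM u v :
  cliff_gen u * cliff_gen v + cliff_gen v * cliff_gen u = (2%:R * b u v)%:A.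
Proof.
set t := tensor_gen u * tensor_gen v + tensor_gen v * tensor_gen u
          - (2%:R * b u v)%:A.
have /eqP : qa_proj cliff_ideal t = 0.
  apply/eqP; rewrite qa_proj_eq0.
  by apply/mem_ideal_gen; exists u, v.
by rewrite rmorphB rmorphD !rmorphM /= linearZ /= rmorph1 subr_eq0 => /eqP.
Qed.

Lemma clifford_ind (P : clifford -> Prop) :
    P 1 -> (forall a x y, P x -> P y -> P (a *: x + y)) ->
    (forall v x, P x -> P (cliff_gen v * x)) -> forall x, P x.
Proof.
move=> P1 PD PM; elim/qa_ind; elim/tensor_alg_ind => [|a x y Px Py|v x Px].
- by rewrite rmorph1.
- by rewrite linearP; exact: PD.
- by rewrite rmorphM; exact: PM.
Qed.

Section CliffLift.
Variables (B : algType F) (f : {linear V -> B}).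
Hypothesis fM : forall u v, f u * f v + f v * f u = (2%:R * b u v)%:A.

Definition cliff_lift : clifford -> B :=
  qa_lift (I := cliff_ideal) (lrmorph_ideal_gen (tensor_lift_cliff_rel fM)).
HB.instance Definition _ := GRing.LRMorphism.on cliff_lift.

Lemma cliff_lift_gen v : cliff_lift (cliff_gen v) = f v.
Proof. by rewrite /cliff_lift qa_liftE /= tensor_lift_gen. Qed.
End CliffLift.

Lemma cliff_lift_unique (B : algType F) (g h : {lrmorphism clifford -> B}) :
  (forall v, g (cliff_gen v) = h (cliff_gen v)) -> g =1 h.
Proof.
move=> gh; elim/clifford_ind => [|a x y gx gy|v x gx].
- by rewrite !rmorph1.
- by rewrite !linearP /= gx gy.
- by rewrite !rmorphM /= gh gx.
Qed.

Definition clifford_sub (W : {pred V}) : {pred clifford} :=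
  subalg_gen (fun x => exists2 w, w \in W & x = cliff_gen w).

End Clifford.

Arguments cliff_gen {F V} b v.
Arguments clifford_sub {F V} b W.

Record isom (F : fieldType) (V V' : lmodType F)
    (b : {symmetric V}) (b' : {symmetric V'}) := Isom {
  isom_fun :> {linear V -> V'};
  isom_isometry : isometry b' b isom_fun
}.

Section IsomComp.
Variables (F : fieldType) (V1 V2 V3 : lmodType F).
Variables (b1 : {symmetric V1}) (b2 : {symmetric V2}) (b3 : {symmetric V3}).
Variables (g : isom b2 b3) (f : isom b1 b2).

Lemma isom_comp_isometry : isometry b3 b1 (g \o f).
Proof. by move=> u v; rewrite /= !isom_isometry. Qed.
Definition isom_comp : isom b1 b3 := Isom isom_comp_isometry.
End IsomComp.

Section CliffordMap.
Variables (F : fieldType) (V V' : lmodType F).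
Variables (b : {symmetric V}) (b' : {symmetric V'}) (f : isom b b').

Lemma clifford_map_rel u v :
  (cliff_gen b' \o f) u * (cliff_gen b' \o f) v +
  (cliff_gen b' \o f) v * (cliff_gen b' \o f) u = (2%:R * b u v)%:A.
Proof. by rewrite /= cliff_genM isom_isometry. Qed.

Definition clifford_map : clifford b -> clifford b' := cliff_lift clifford_map_rel.
HB.instance Definition _ := GRing.LRMorphism.on clifford_map.

Lemma clifford_map_gen v : clifford_map (cliff_gen b v) = cliff_gen b' (f v).
Proof. exact: cliff_lift_gen. Qed.

Lemma clifford_map_unique (g : {lrmorphism clifford b -> clifford b'}) :
  (forall v, g (cliff_gen b v) = cliff_gen b' (f v)) -> g =1 clifford_map.
Proof.
by move=> gf; apply: cliff_lift_unique => v; rewrite gf /= clifford_map_gen.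
Qed.
End CliffordMap.

Definition radical (F : fieldType) (V : lmodType F) (b : {symmetric V}) :
  {pred V} := fun v => `[< forall v', b v v' = 0 >].

Definition line (F : fieldType) (V : lmodType F) (e0 : V) : {pred V} :=
  fun v => `[< exists a : F, v = a *: e0 >].

Section QuotientByLine.
Variables (F : fieldType) (V : lmodType F) (e0 : V).

Lemma lineP v : reflect (exists a : F, v = a *: e0) (v \in line e0).
Proof. exact: asboolP. Qed.

Lemma line_submod_closed : GRing.submod_closed (line e0).
Proof.
split=> [|k u v /lineP [a ->] /lineP [c ->]]; apply/lineP.
  by exists 0; rewrite scale0r.
by exists (k * a + c); rewrite scalerDl scalerA.
Qed.
HB.instance Definition _ :=
  GRing.isSubmodClosed.Build F V (line e0) line_submod_closed.

Definition quot_line := {ideal_quot (line e0)}.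
HB.instance Definition _ := GRing.Zmodule.on quot_line.

Definition line_proj (v : V) : quot_line := \pi_{ideal_quot (line e0)} v.
Definition line_repr (q : quot_line) : V := repr (q : {ideal_quot (line e0)}).

Lemma line_reprK : cancel line_repr line_proj.
Proof. exact: (@reprK _ {ideal_quot (line e0)}). Qed.

Lemma line_projP u v : reflect (line_proj u = line_proj v) (u - v \in line e0).
Proof. by rewrite Quotient.idealrBE; exact: eqP. Qed.

Lemma line_proj_zmod : zmod_morphism line_proj.
Proof. exact: (raddfB \pi_{ideal_quot (line e0)}). Qed.
HB.instance Definition _ :=
  GRing.isZmodMorphism.Build V quot_line line_proj line_proj_zmod.

Lemma quot_line_ind (P : quot_line -> Prop) :
  (forall v, P (line_proj v)) -> forall q, P q.
Proof. by move=> H q; rewrite -[q]line_reprK. Qed.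

Lemma line_repr_proj v : line_repr (line_proj v) - v \in line e0.
Proof. by apply/line_projP; rewrite line_reprK. Qed.

Definition quot_line_scale (a : F) (q : quot_line) : quot_line :=
  line_proj (a *: line_repr q).

Lemma quot_line_scaleE a v :
  quot_line_scale a (line_proj v) = line_proj (a *: v).
Proof.
apply/line_projP; rewrite -scalerBr.
have /lineP [c ->] := line_repr_proj v.
by apply/lineP; exists (a * c); rewrite scalerA.
Qed.

Lemma quot_line_scaleA a c q :
  quot_line_scale a (quot_line_scale c q) = quot_line_scale (a * c) q.
Proof. by elim/quot_line_ind: q => v; rewrite !quot_line_scaleE scalerA. Qed.
Lemma quot_line_scale1 : left_id 1 quot_line_scale.
Proof. by elim/quot_line_ind=> v; rewrite quot_line_scaleE scale1r. Qed.
Lemma quot_line_scaleDr : right_distributive quot_line_scale +%R.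
Proof.
move=> a; elim/quot_line_ind=> u; elim/quot_line_ind=> v.
by rewrite -raddfD !quot_line_scaleE scalerDr raddfD.
Qed.
Lemma quot_line_scaleDl q : {morph quot_line_scale^~ q : a c / a + c}.
Proof.
move=> a c; elim/quot_line_ind: q => v.
by rewrite !quot_line_scaleE scalerDl raddfD.
Qed.
HB.instance Definition _ := GRing.Zmodule_isLmodule.Build F quot_line
  quot_line_scaleA quot_line_scale1 quot_line_scaleDr quot_line_scaleDl.

Lemma line_proj_scalable : scalable line_proj.
Proof. by move=> a v; rewrite -quot_line_scaleE. Qed.
HB.instance Definition _ :=
  GRing.isScalable.Build F V quot_line *:%R line_proj line_proj_scalable.

Variables (b : {symmetric V}) (e0rad : e0 \in radical b).

Definition quot_form of e0 \in radical b :=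
  fun p q : quot_line => b (line_repr p) (line_repr q).
Local Notation qform := (quot_form e0rad).

Lemma quot_formE u v : qform (line_proj u) (line_proj v) = b u v.
Proof.
have bl x y : b x y = b y x by exact: symformC.
have b0 x y z : x - y \in line e0 -> b x z = b y z.
  move=> /lineP [a /eqP]; rewrite subr_eq => /eqP ->.
  by rewrite linearPl /= (asboolP _ e0rad) mulr0 add0r.
rewrite /quot_form (b0 _ u _ (line_repr_proj u)) bl.
by rewrite (b0 _ v _ (line_repr_proj v)) bl.
Qed.

Lemma quot_form_bilinear :
  bilinear_for (GRing.Scale.Law.clone F F *%R _)
    (GRing.Scale.Law.clone F F (idfun \; *%R) _) qform.
Proof.
split=> q a; elim/quot_line_ind: q => w; elim/quot_line_ind=> u;
  elim/quot_line_ind=> v; rewrite /= -(linearP line_proj) /= !quot_formE.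
  by rewrite linearPl.
by rewrite !(symformC b w) linearPl.
Qed.
HB.instance Definition _ :=
  bilinear_isBilinear.Build F quot_line quot_line F _ _ qform quot_form_bilinear.
Lemma quot_form_sym p q : qform p q = (-1) ^+ false * idfun (qform q p).
Proof. exact: hermitian_subproof. Qed.
HB.instance Definition _ :=
  isHermitianSesquilinear.Build F quot_line false idfun qform quot_form_sym.

Lemma line_proj_isometry : isometry qform b line_proj.
Proof. by move=> u v; exact: quot_formE. Qed.
Definition proj_isom : isom b qform := Isom line_proj_isometry.

End QuotientByLine.

Definition complement (F : fieldType) (V : lmodType F) (e0 : V)
    (W : {pred V}) : Prop :=
  [/\ GRing.submod_closed W,
      forall v, exists w l, [/\ w \in W, l \in line e0 & v = w + l] &
      forall v, v \in W -> v \in line e0 -> v = 0].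

Section Playfair.
Variables (F : fieldType) (V : lmodType F) (b : {symmetric V}).
Variables (e0 : V) (e0rad : e0 \in radical b).
Variables (W : {pred V}) (We0 : complement e0 W).

Lemma complement_surj (q : quot_line e0) :
  exists w, (w \in W) && (line_proj e0 w == q).
Proof.
elim/quot_line_ind: q => v; have [_ /(_ v) [w [l [Ww Ll vE]]] _] := We0.
exists w; rewrite Ww; apply/eqP/line_projP.
by rewrite vE opprD addNKr rpredN.
Qed.

Lemma complement_inj : {in W &, injective (line_proj e0)}.
Proof.
move=> u v Wu Wv /line_projP uv; have [Wc _ W0] := We0.
have [_ Wlin] := Wc; apply/eqP; rewrite -subr_eq0 (W0 (u - v)) //.
by rewrite addrC -scaleN1r Wlin.
Qed.

Definition section_fun of complement e0 W := fun q => xchoose (complement_surj q).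
Local Notation omega := (section_fun We0).

Lemma section_in q : omega q \in W.
Proof. by have /andP [] := xchooseP (complement_surj q). Qed.
Lemma section_funK : cancel omega (line_proj e0).
Proof. by move=> q; have /andP [_ /eqP] := xchooseP (complement_surj q). Qed.
Lemma section_projK : {in W, cancel (line_proj e0) omega}.
Proof.
by move=> w Ww; apply: complement_inj; rewrite ?section_in ?section_funK.
Qed.

Lemma section_linear : linear omega.
Proof.
have [[_ Wlin] _ _] := We0.
move=> a p q; apply: complement_inj; first exact: section_in.
  by apply: Wlin; exact: section_in.
by rewrite section_funK linearP /= !section_funK.
Qed.
HB.instance Definition _ :=
  GRing.isLinear.Build F (quot_line e0) V *:%R omega section_linear.

Lemma section_isometry : isometry b (quot_form e0rad) omega.
Proof. by move=> p q; rewrite -(quot_formE e0rad) !section_funK. Qed.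
Definition section_isom : isom (quot_form e0rad) b := Isom section_isometry.

Definition playfair : isom b b := isom_comp section_isom (proj_isom e0rad).

End Playfair.

(* Main.v *)
(** A radical vector [e0] anticommutes with every vector and, as the
    characteristic is not 2, squares to 0 in the Clifford algebra; hence
    [e0 Z = Z' e0] with [Z'] the grade involute of [Z], and [e0 Z e0 = 0].
    Multiplying [X = p X + Y e0] on the left by [v = w + a e0], with [w] in [W],
    yields [v X = w (p X) + (w Y + a (p X)') e0]. *)
Require Import Defs.
From mathcomp Require Import all_boot all_order all_algebra.
From mathcomp Require Import boolp.

Import GRing.Theory.
Local Open Scope ring_scope.

Section CliffordSub.
Context {F : fieldType} {V : lmodType F} {b : {symmetric V}} {W : {pred V}}.
Local Notation CW := (clifford_sub b W).

Lemma clifford_sub_gen w : w \in W -> cliff_gen b w \in CW.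
Proof. by move=> Ww; apply: mem_subalg_gen; exists w. Qed.

Lemma clifford_sub1 : 1 \in CW.
Proof. by case: (subalg_gen_closed
  (fun x : clifford b => exists2 w, w \in W & x = cliff_gen b w)). Qed.

Lemma clifford_subP a x y : x \in CW -> y \in CW -> a *: x + y \in CW.
Proof. by case: (subalg_gen_closed
  (fun x : clifford b => exists2 w, w \in W & x = cliff_gen b w)) => _ CP _; apply: CP. Qed.

Lemma clifford_subM x y : x \in CW -> y \in CW -> x * y \in CW.
Proof. by case: (subalg_gen_closed
  (fun x : clifford b => exists2 w, w \in W & x = cliff_gen b w)) => _ _; apply. Qed.

Lemma clifford_sub0 : 0 \in CW.
Proof.
by have := clifford_subP (-1) _ _ clifford_sub1 clifford_sub1; rewrite scaleN1r addNr.
Qed.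

Lemma clifford_subN x : x \in CW -> - x \in CW.
Proof.
move=> Cx; rewrite -scaleN1r -[_ *: _]addr0.
exact: clifford_subP Cx clifford_sub0.
Qed.

(** Induction on left multiplication by a vector: each new factor is sent to a generator from
    [W]. *)
Lemma clifford_map_in_sub {V' : lmodType F} {b' : {symmetric V'}}
    {f : isom b' b} :
  (forall v, f v \in W) -> forall x, clifford_map f x \in CW.
Proof.
move=> fW; elim/clifford_ind => [|a x y Cx Cy|v x Cx].
- by rewrite rmorph1; exact: clifford_sub1.
- by rewrite linearP; exact: clifford_subP.
- rewrite rmorphM /= clifford_map_gen.
  exact: clifford_subM (clifford_sub_gen _ (fW v)) Cx.
Qed.

End CliffordSub.

Section RadicalVector.
Context {F : fieldType} {V : lmodType F} {b : {symmetric V}}.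
Context {e0 : V} (e0_rad : e0 \in radical b).
Local Notation e := (cliff_gen b e0).

(** In the Clifford relation for [e0] and [v], the right-hand side [2 b(e0, v)] vanishes. *)
Lemma cliff_gen_radical_anticomm v : e * cliff_gen b v = - (cliff_gen b v * e).
Proof.
apply/eqP; rewrite -addr_eq0 cliff_genM (asboolP _ e0_rad).
by rewrite mulr0 scale0r.
Qed.

Lemma cliff_gen_radical_sqr : 2%N \notin [pchar F] -> e * e = 0.
Proof.
(* Anticommuting with itself gives [2 e^2 = 0]; the characteristic hypothesis unfolds to [2 != 0] in
   [F]. *)
rewrite inE /= => two_neq0; have /eqP := cliff_gen_radical_anticomm e0.
rewrite -addr_eq0 -mulr2n -scaler_nat scaler_eq0 (negbTE two_neq0) /=.
by move/eqP.
Qed.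

(** The [z] admitting such a [z'] form a subalgebra containing [W]. Mere existence of [z'] suffices,
    so the grade involution need not be constructed; [z'] stays in [Cl(W)], as the new [Y] must. *)
Lemma radical_skew_comm {W : {pred V}} z : z \in clifford_sub b W ->
  exists2 z', z' \in clifford_sub b W & e * z = z' * e.
Proof.
pose B z := `[< exists2 z', z' \in clifford_sub b W & e * z = z' * e >].
move=> /subalg_genP Hz; apply/asboolP; apply: (Hz B).
- split=> [|a x y /asboolP [x' Cx' ex] /asboolP [y' Cy' ey]
            |x y /asboolP [x' Cx' ex] /asboolP [y' Cy' ey]]; apply/asboolP.
  + by exists 1; rewrite ?mulr1 ?mul1r //; exact: clifford_sub1.
  + exists (a *: x' + y'); first exact: clifford_subP.
    by rewrite mulrDr mulrDl -scalerAr -scalerAl ex ey.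
  + exists (x' * y'); first exact: clifford_subM.
    by rewrite mulrA ex -mulrA ey mulrA.
- move=> _ [w Ww ->]; apply/asboolP; exists (- cliff_gen b w).
    exact/clifford_subN/clifford_sub_gen.
  by rewrite mulNr cliff_gen_radical_anticomm.
Qed.

Context {W : {pred V}} (W_compl : complement e0 W).
Local Notation p := (playfair e0_rad W_compl).

Lemma playfair_in v : p v \in W.
Proof. exact: section_in. Qed.

(** [v] and [p v] have the same class modulo the line, since the section is a right inverse of the
    projection. *)
Lemma playfair_decomp v : exists a : F, v = p v + a *: e0.
Proof.
have /lineP [a /eqP] : v - p v \in line e0.
  by apply/line_projP; rewrite /= section_funK.
by rewrite subr_eq addrC => /eqP vE; exists a.
Qed.

End RadicalVector.

Theorem lemma3p2 (F : fieldType) (charF : 2%N \notin [pchar F])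
    (V : lmodType F) (b : {symmetric V})
    (e0 : V) (e0_rad : e0 \in radical b) (e0_neq0 : e0 != 0)
    (W : {pred V}) (W_compl : complement e0 W) (X : clifford b) :
  exists2 Y : clifford b, Y \in clifford_sub b W &
    X = clifford_map (playfair e0_rad W_compl) X + Y * cliff_gen b e0.
Proof.
have pW := playfair_in e0_rad W_compl.
(* The case of substance is the third, left multiplication by one vector [v]. *)
elim/clifford_ind: X => [|a x y [x' Cx' xE] [y' Cy' yE]|v x [y Cy xE]].
- exists 0; first exact: clifford_sub0.
  by rewrite rmorph1 mul0r addr0.
- exists (a *: x' + y'); first exact: clifford_subP.
  by rewrite linearP mulrDl -scalerAl addrACA -scalerDr -xE -yE.
- have [a vE] := playfair_decomp e0_rad W_compl v.
  have [z Cz zE] := radical_skew_comm e0_rad _ (clifford_map_in_sub pW x).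
  (* Moving [e0] past [y] produces [e0^2 = 0]; characteristic not 2 enters here. This kills the
     cross term of [a e0] with [y e0]. *)
  have eye0 : cliff_gen b e0 * (y * cliff_gen b e0) = 0.
    have [y' _ y'E] := radical_skew_comm e0_rad _ Cy.
    by rewrite mulrA y'E -mulrA cliff_gen_radical_sqr // mulr0.
  set w := playfair _ _ v in vE *.
  (* Coefficient of [e0] in [(w + a e0)(p x + y e0)], where [z] is the skew-commuted [p x], that is,
     [e0 (p x) = z e0]. *)
  exists (a *: z + cliff_gen b w * y).
    apply: clifford_subP => //.
    exact: clifford_subM (clifford_sub_gen _ (pW v)) Cy.
  rewrite rmorphM /= clifford_map_gen -/w {1}vE {1}xE linearD linearZ /=.
  rewrite mulrDl !mulrDr -!scalerAl zE eye0 scaler0 addr0 mulrDl -scalerAl.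
  by rewrite mulrA -addrA [_ * _ * _ + _]addrC.
Qed.
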